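(* Let $G\le G_f$, and let $L\subset\mathbb{C}^m$ be a $G$-invariant, almost-calibrated Lagrangian translating soliton with no linear factor. Then $G\le\mathrm{ASU}(m-1)$.
   Context: $m\ge2$; $\mathrm{AU}(m)=\mathrm U(m)\ltimes\mathbb{C}^m$ acts on $\mathbb{C}^m$ by $(A,t)\cdot z=Az+t$. $G_f\le\mathrm{AU}(m)$ is the subgroup of elements preserving the form $\Omega_f=e^{z_m}dz_1\wedge\dots\wedge dz_m$; explicitly it consists of those elements of $\mathrm{AU}(m)$ of the form $\left(\begin{pmatrix}B&b\\0&1\end{pmatrix},\begin{pmatrix}t'\\-i\theta\end{pmatrix}\right)$ with $B\in\mathrm U(m-1)$, $b,t'\in\mathbb{C}^{m-1}$, $\theta\in\mathbb{R}$, $e^{i\theta}=\det B$. $\mathrm{ASU}(m-1)=\mathrm{SU}(m-1)\ltimes\mathbb{C}^{m-1}$ is the affine special unitary group, regarded as acting on the first $m-1$ coordinates of $\mathbb{C}^m=\mathbb{C}^{m-1}\times\mathbb{C}$ and trivially on the last. A Lagrangian translating soliton (in the $e_m$ direction) is an (oriented) Lagrangian with mean curvature vector $\vec H=e_m^\perp$, where $e_m=(0,\dots,0,1)$; then the Lagrangian angle $\theta_L$ (defined by $dz_1\wedge\dots\wedge dz_m|_L=e^{i\theta_L}\mathrm{vol}_L$) satisfies $\theta_L+\mathrm{Im}(z_m)=c$ for a constant $c$. It is almost-calibrated if $\theta_L$ is a real-valued function whose range is less than $\pi$. $L$ has no linear factor if it is not a Riemannian product of some $L'$ with a line.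
   Formalization: L is assumed nonempty and connected, as the single constant c in θ_L + Im(z_m) = c presupposes; without connectedness the claim fails for the union of all translates of one soliton by 2πik e_m, k an integer. *)

(* Defs.v *)
From HB Require Import structures.
From mathcomp Require Import all_boot all_order all_algebra.
From mathcomp Require Import complex.
From mathcomp Require Import all_classical all_reals all_analysis.

Set Implicit Arguments.
Unset Strict Implicit.
Unset Printing Implicit Defensive.

Import Order.TTheory GRing.Theory Num.Theory.
Import numFieldNormedType.Exports.

Local Open Scope classical_set_scope.
Local Open Scope ring_scope.
Local Open Scope complex_scope.

(** ** Euclidean, Hermitian and symplectic structure of C^m *)

(** The standard inner product of C^m = R^(2m). *)
Definition inner (R : realType) (m : nat) (z w : 'cV[R[i]]_m) : R :=
  \sum_(j < m) (complex.Re (z j 0) * complex.Re (w j 0)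
              + complex.Im (z j 0) * complex.Im (w j 0)).

(** The standard symplectic form [\sum_j dx_j /\ dy_j], where
    [z_j = x_j + i y_j]. *)
Definition omega (R : realType) (m : nat) (z w : 'cV[R[i]]_m) : R :=
  \sum_(j < m) (complex.Re (z j 0) * complex.Im (w j 0)
              - complex.Im (z j 0) * complex.Re (w j 0)).

Definition expi (R : realType) (t : R) : R[i] := cos t +i* sin t.

Definition cexp (R : realType) (z : R[i]) : R[i] :=
  (expR (complex.Re z))%:C * expi (complex.Im z).

(** Throughout, [C^m] with [m = n + 1] is [C^n * C]; [last_ord] is the index of
    the last coordinate. *)
Definition last_ord (n : nat) : 'I_(n + 1) := rshift n ord0.

Definition e_last (R : realType) (n : nat) : 'cV[R[i]]_(n + 1) :=
  delta_mx (last_ord n) 0.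

(** ** Affine groups *)

(** The pair [(A, t)] stands for the map [z |-> A z + t]. *)
Definition affine (R : realType) (m : nat) : Type :=
  ('M[R[i]]_m * 'cV[R[i]]_m)%type.

Definition act (R : realType) (m : nat) (g : affine R m) (z : 'cV[R[i]]_m) :
  'cV[R[i]]_m := g.1 *m z + g.2.

Definition aff_one (R : realType) (m : nat) : affine R m := (1%:M, 0).

Definition aff_mul (R : realType) (m : nat) (g h : affine R m) : affine R m :=
  (g.1 *m h.1, g.1 *m h.2 + g.2).

Definition aff_inv (R : realType) (m : nat) (g : affine R m) : affine R m :=
  (invmx g.1, - (invmx g.1 *m g.2)).

Definition AU (R : realType) (m : nat) : set (affine R m) :=
  [set g | g.1 \is unitarymx].

Definition is_subgroup (R : realType) (m : nat) (G H : set (affine R m)) :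
  Prop :=
  [/\ G `<=` H, G (aff_one R m),
      (forall g h, G g -> G h -> G (aff_mul g h)) &
      (forall g, G g -> G (aff_inv g))].

(** [Omega_f z V] is the value at [z] of [e^(z_m) dz_1 /\ ... /\ dz_m] on the
    [m] tangent vectors which are the columns of [V]. *)
Definition Omega_f (R : realType) (n : nat)
    (z : 'cV[R[i]]_(n + 1)) (V : 'M[R[i]]_(n + 1)) : R[i] :=
  cexp (z (last_ord n) 0) * \det V.

(** The differential of [act g] is [g.1], so the equation below says that the
    pullback of [Omega_f] by [act g] is [Omega_f]. *)
Definition Gf (R : realType) (n : nat) : set (affine R (n + 1)) :=
  [set g | AU g /\
    forall z V, Omega_f (act g z) (g.1 *m V) = Omega_f z V].

Definition ASU (R : realType) (n : nat) : set (affine R (n + 1)) :=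
  [set g | exists (B : 'M[R[i]]_n) (t : 'cV[R[i]]_n),
    [/\ B \is unitarymx, \det B = 1 &
        g = (block_mx B 0 0 1%:M, col_mx t 0)]].

(** ** Differential calculus of maps from R^k to C^m *)

Section Calculus.
Variables (R : realType) (k m : nat).
Implicit Types (f : 'rV[R]_k -> 'cV[R[i]]_m) (V : set 'rV[R]_k).

Definition dir_deriv (v : 'rV[R]_k) f : 'rV[R]_k -> 'cV[R[i]]_m :=
  fun u => \col_i ('D_v (fun x => complex.Re (f x i 0) : R) u
                +i* 'D_v (fun x => complex.Im (f x i 0) : R) u).

Definition partial (j : 'I_k) f : 'rV[R]_k -> 'cV[R[i]]_m :=
  dir_deriv (delta_mx 0 j) f.

(** C^oo on the open set [V]: every iterated directional derivative is
    differentiable at every point of [V]. *)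
Definition smooth_on V f : Prop :=
  forall (vs : seq 'rV[R]_k) (i : 'I_m) (u : 'rV[R]_k), V u ->
    differentiable (fun x => complex.Re (foldr dir_deriv f vs x i 0) : R) u /\
    differentiable (fun x => complex.Im (foldr dir_deriv f vs x i 0) : R) u.

Definition immersion_on V f : Prop :=
  forall u v, V u -> dir_deriv v f u = 0 -> v = 0.

(** The complex matrix whose columns are the coordinate vectors. *)
Definition jac f (u : 'rV[R]_k) : 'M[R[i]]_(m, k) :=
  \matrix_(i, j) partial j f u i 0.

Definition first_form f (u : 'rV[R]_k) : 'M[R]_k :=
  \matrix_(i, j) inner (partial i f u) (partial j f u).

Definition vol_density f (u : 'rV[R]_k) : R :=
  Num.sqrt (\det (first_form f u)).

Definition normal_part f (u : 'rV[R]_k) (w : 'cV[R[i]]_m) : 'cV[R[i]]_m :=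
  w - \sum_(i < k) \sum_(j < k)
        (invmx (first_form f u) i j * inner w (partial i f u))%:C
          *: partial j f u.

(** The trace (not the average) of the second fundamental form
    [II(d_i, d_j) = (d_i d_j f)^perp]. *)
Definition mean_curvature f (u : 'rV[R]_k) : 'cV[R[i]]_m :=
  \sum_(i < k) \sum_(j < k)
    (invmx (first_form f u) i j)%:C
      *: normal_part f u (partial i (partial j f) u).

End Calculus.

(** ** Immersed submanifolds of C^m *)

(** [(V, phi)] is a local parametrization: [phi] is a homeomorphism from the
    open set [V] of R^k onto an open set of [M], and [F \o phi] is a smooth
    immersion. Values of [phi] outside [V] are irrelevant. *)
Definition local_param (R : realType) (k m : nat) (M : topologicalType)
    (F : M -> 'cV[R[i]]_m) (c : set 'rV[R]_k * ('rV[R]_k -> M)) : Prop :=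
  let: (V, phi) := c in
  [/\ open V, {in V, continuous phi}, {in V &, injective phi},
      (forall W : set 'rV[R]_k, open W -> W `<=` V -> open (phi @` W)) &
      smooth_on V (F \o phi) /\ immersion_on V (F \o phi)].

(** A k-dimensional submanifold of C^m, immersed by [imm]. The transition maps
    of the atlas are automatically smooth since each [imm \o phi] is a smooth
    immersion. An embedded submanifold [L] is the case where [points] is the
    subspace [L] and [imm] is the inclusion. *)
Record submanifold (R : realType) (k m : nat) := Submanifold {
  points :> topologicalType ;
  imm : points -> 'cV[R[i]]_m ;
  atlas : set (set 'rV[R]_k * ('rV[R]_k -> points)) ;
  points_hausdorff : hausdorff_space points ;
  points_second_countable : @second_countable points ;
  atlas_param : forall c, atlas c -> local_param imm c ;
  atlas_cover : forall p : points,
    exists2 c, atlas c & exists2 u, c.1 u & c.2 u = p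
}.

Arguments imm {R k m} _ _.
Arguments atlas {R k m} _ _.

(** The charts are all positively oriented: [A] is the differential of the
    transition map. *)
Definition oriented (R : realType) (k m : nat) (L : submanifold R k m) :
  Prop :=
  forall c1 c2 u1 u2, atlas L c1 -> atlas L c2 -> c1.1 u1 -> c2.1 u2 ->
    c1.2 u1 = c2.2 u2 ->
    exists A : 'M[R]_k, 0 < \det A /\
      jac (imm L \o c1.2) u1
        = jac (imm L \o c2.2) u2 *m map_mx (fun x : R => x%:C) A.

Definition lagrangian (R : realType) (m : nat) (L : submanifold R m m) : Prop :=
  forall c u, atlas L c -> c.1 u -> forall i j,
    omega (partial i (imm L \o c.2) u) (partial j (imm L \o c.2) u) = 0.

Definition lagrangian_translating_soliton (R : realType) (n : nat)
    (L : submanifold R (n + 1) (n + 1)) : Prop :=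
  [/\ oriented L, lagrangian L &
      forall c u, atlas L c -> c.1 u ->
        mean_curvature (imm L \o c.2) u
          = normal_part (imm L \o c.2) u (e_last R n)].

(** [dz_1 /\ ... /\ dz_m = e^(i theta) vol_L] on [L], evaluated on the
    positively oriented coordinate frames. *)
Definition lagrangian_angle (R : realType) (m : nat) (L : submanifold R m m)
    (theta : L -> R) : Prop :=
  forall c u, atlas L c -> c.1 u ->
    \det (jac (imm L \o c.2) u)
      = expi (theta (c.2 u)) * (vol_density (imm L \o c.2) u)%:C.

Definition almost_calibrated (R : realType) (m : nat) (L : submanifold R m m) :
  Prop :=
  exists theta : L -> R,
    [/\ continuous theta, lagrangian_angle theta &
        exists a b : R, b - a < pi /\ forall p, a <= theta p <= b].

(** [L] is the Riemannian product of [L'] with the line spanned by the unit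
    vector [v]: the immersion of [L] is [(p, s) |-> p + s v], with [L'] in the
    orthogonal complement of [v]. *)
Definition has_linear_factor (R : realType) (n m : nat)
    (L : submanifold R (n + 1) m) : Prop :=
  exists (L' : submanifold R n m) (v : 'cV[R[i]]_m)
         (h : L' * R -> L) (h' : L -> L' * R),
    [/\ inner v v = 1, (forall p : L', inner (imm L' p) v = 0),
        (continuous h /\ continuous h'), (cancel h h' /\ cancel h' h) &
        forall (p : L') (s : R), imm L (h (p, s)) = imm L' p + s%:C *: v].

Definition invariant_under (R : realType) (k m : nat) (G : set (affine R m))
    (L : submanifold R k m) : Prop :=
  forall g, G g -> act g @` range (imm L) = range (imm L).

(* Main.v *)
Require Import Defs.
From mathcomp Require Import all_boot all_order all_algebra.
From mathcomp Require Import perm complex ring lra.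
From mathcomp Require Import all_classical all_reals all_analysis.

Set Implicit Arguments.
Unset Strict Implicit.
Unset Printing Implicit Defensive.

Import Order.TTheory GRing.Theory Num.Theory.
Import numFieldNormedType.Exports.

Local Open Scope classical_set_scope.
Local Open Scope ring_scope.
Local Open Scope complex_scope.

(* Write theta for the Lagrangian angle. In a parametrization F with complex
   Jacobian J, (log det J)' = tr (J^-1 J') has imaginary part d theta, and
   J^-1 = g^-1 J^* because the Lagrangian condition makes J^* J the real Gram
   matrix g. The total symmetry of omega(d_i F, d_j d_k F) turns this imaginary
   part into omega(dF, H), and H = e_m^perp gives omega(dF, e_m) = - d(Im z_m).
   Hence theta + Im z_m is constant on the connected L, so Im z_m is bounded on
   L. An element of G_f translates z_m by an imaginary constant, and its iterates
   preserve L, so this constant vanishes; then det A = 1 since e^(z_m) det A is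
   preserved. *)

(** * Directional derivatives along lines and the symmetry of second derivatives *)

Section LineDerivatives.
Variables (R : realType) (E : normedModType R).

Lemma is_derive_line (f : E -> R) (u v : E) (s df : R) :
  is_derive (u + s *: v) v f df ->
  is_derive s 1 (fun x : R => f (u + x *: v)) df.
Proof.
move=> [H1 H2].
have e : (fun h => h^-1 *: ((f \o shift (u + s *: v)) (h *: v) - f (u + s *: v))) =
  (fun h : R => h^-1 *: (((fun x : R => f (u + x *: v)) \o shift s) (h *: 1)
     - f (u + s *: v))).
  apply/funext => h /=; do 3 f_equal.
  by rewrite [h *: 1]mulr1 scalerDl addrCA.
by split; [rewrite /derivable -e | rewrite /derive -e].
Qed.

Lemma is_derive_translate (f : E -> R) (c u v : E) (df : R) :
  is_derive (u + c) v f df -> is_derive u v (fun x => f (x + c)) df.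
Proof.
move=> [H1 H2].
have e : (fun h => h^-1 *: ((f \o shift (u + c)) (h *: v) - f (u + c))) =
  (fun h : R => h^-1 *: (((fun x => f (x + c)) \o shift u) (h *: v) - f (u + c))).
  by apply/funext => h /=; rewrite !addrA.
by split; [rewrite /derivable -e | rewrite /derive -e].
Qed.

Lemma line_MVT (f df : E -> R) (u v : E) (s : R) : 0 < s ->
  (forall x, 0 <= x <= s -> is_derive (u + x *: v) v f (df (u + x *: v))) ->
  exists2 x, 0 <= x <= s & f (u + s *: v) - f u = df (u + x *: v) * s.
Proof.
move=> s0 H.
have D x : x \in `[0, s] ->
    is_derive x 1 (fun x : R => f (u + x *: v)) (df (u + x *: v)).
  by rewrite in_itv /= => /H /is_derive_line.
have D' x : x \in `]0, s[ ->
    is_derive x 1 (fun x : R => f (u + x *: v)) (df (u + x *: v)).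
  by move=> /subset_itv_oo_cc; exact: D.
have C : {within `[0, s], continuous (fun x : R => f (u + x *: v))}.
  by apply: derivable_within_continuous => x /D [].
have [x xs e] := MVT s0 D' C.
exists x; first by move: xs; rewrite in_itv /= => /andP[/ltW -> /ltW ->].
by move: e; rewrite /= scale0r addr0 subr0.
Qed.

Lemma nbhs_parallelogram (W : set E) (u a b : E) : nbhs u W ->
  exists2 s : R, 0 < s & forall x y, 0 <= x <= s -> 0 <= y <= s ->
    W (u + x *: a + y *: b).
Proof.
move=> /nbhs_ballP [r /= r0 rW].
have d0 : 0 < `|a| + `|b| + 1 by rewrite ltr_wpDl // addr_ge0.
(* The [+ 1] keeps the denominator positive when [a] and [b] vanish, and the half turns the closed
   bounds on [x] and [y] into a strict distance bound. *)
exists (r / (`|a| + `|b| + 1) / 2); first by rewrite !divr_gt0.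
move=> x y /andP[x0 xs] /andP[y0 ys]; apply: rW.
rewrite -ball_normE /ball_ /= -addrA opprD addNKr normrN.
rewrite (le_lt_trans (ler_normD _ _)) // !normrZ !ger0_norm //.
set s := r / _ / 2 in xs ys.
apply: (@le_lt_trans _ _ (s * (`|a| + `|b| + 1))).
  rewrite !mulrDr mulr1 -[leLHS]addr0 lerD ?(le_trans x0 xs) //.
  by rewrite lerD // ler_wpM2r.
by rewrite /s mulrAC divfK ?gt_eqF // ltr_pdivrMr // mulr_natr mulr2n ltrDl.
Qed.

Lemma continuous_near_dist (f : E -> R) (u : E) (e : R) :
  {for u, continuous f} -> 0 < e -> nbhs u (fun z => `|f u - f z| < e).
Proof. by move/cvgrPdist_lt => + e0; exact. Qed.

(** The mean value theorem is applied twice: along [a] to the increment [f (y + s *: b) - f y], then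
    along [b] to ['D_a f]. *)
Lemma second_difference (f : E -> R) (V : set E) (a b u : E) (s : R) :
  (forall x, V x -> derivable f x a) ->
  (forall x, V x -> derivable ('D_a f) x b) -> 0 < s ->
  (forall x y, 0 <= x <= s -> 0 <= y <= s -> V (u + x *: a + y *: b)) ->
  exists x y, [/\ 0 <= x <= s, 0 <= y <= s &
    f (u + s *: a + s *: b) - f (u + s *: a) - (f (u + s *: b) - f u)
      = 'D_b ('D_a f) (u + x *: a + y *: b) * s * s].
Proof.
move=> fa fab s0 sV.
have ss : 0 <= s <= s by rewrite lexx ltW.
have z0 : 0 <= (0 : R) <= s by rewrite lexx ltW.
pose g y := f (y + s *: b) - f y.
have dg x : 0 <= x <= s -> is_derive (u + x *: a) a g
    ('D_a f (u + x *: a + s *: b) - 'D_a f (u + x *: a)).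
  move=> xs; apply: is_deriveB.
    by apply: is_derive_translate; apply: derivableP; apply: fa; exact: sV.
  apply: derivableP; apply: fa.
  by have := sV x 0 xs z0; rewrite scale0r addr0.
have [x xs ex] := line_MVT (df := fun y => 'D_a f (y + s *: b) - 'D_a f y) s0 dg.
have [|y ys ey] := @line_MVT ('D_a f) ('D_b ('D_a f)) (u + x *: a) b s s0.
  by move=> y ys; apply: derivableP; apply/fab/sV.
by exists x, y; split=> //; rewrite -ey; exact: ex.
Qed.

(** Schwarz's theorem. Over a small parallelogram both mixed derivatives, each at some intermediate
    point, equal the same second difference divided by [s * s]; continuity at [u] brings these
    values close to those at [u]. *)
Lemma derive_comm (f : E -> R) (V : set E) (a b u : E) :
  open V -> V u ->
  (forall x, V x -> derivable f x a) -> (forall x, V x -> derivable f x b) ->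
  (forall x, V x -> derivable ('D_a f) x b) ->
  (forall x, V x -> derivable ('D_b f) x a) ->
  {for u, continuous ('D_b ('D_a f))} -> {for u, continuous ('D_a ('D_b f))} ->
  'D_a ('D_b f) u = 'D_b ('D_a f) u.
Proof.
move=> oV Vu fa fb fab fba c1 c2.
(* No [r] lies within half the distance between [p] and [q] from both of them; [r] will be the
   common value of the mixed derivatives. *)
have midpoint (p q r : R) :
    `|p - r| < `|q - p| / 2 -> `|q - r| < `|q - p| / 2 -> False.
  rewrite distrC => l1 l2; have := ler_distD r q p.
  by rewrite leNgt [ltRHS]splitr ltrD.
apply/eqP; rewrite -subr_eq0 -normr_eq0; apply: contraT => ne0.
have e0 : 0 < `|'D_a ('D_b f) u - 'D_b ('D_a f) u| / 2.
  by rewrite divr_gt0 // lt0r ne0 normr_ge0.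
set e := _ / 2 in e0.
have [s s0 sW] : exists2 s : R, 0 < s & forall x y, 0 <= x <= s -> 0 <= y <= s ->
    [/\ V (u + x *: a + y *: b),
      `|'D_b ('D_a f) u - 'D_b ('D_a f) (u + x *: a + y *: b)| < e &
      `|'D_a ('D_b f) u - 'D_a ('D_b f) (u + x *: a + y *: b)| < e].
  apply: (@nbhs_parallelogram (fun z => [/\ V z,
      `|'D_b ('D_a f) u - 'D_b ('D_a f) z| < e &
      `|'D_a ('D_b f) u - 'D_a ('D_b f) z| < e])).
  have n1 : nbhs u V by exact: open_nbhs_nbhs.
  have n2 : nbhs u (fun z => `|'D_b ('D_a f) u - 'D_b ('D_a f) z| < e).
    exact: continuous_near_dist c1 e0.
  have n3 : nbhs u (fun z => `|'D_a ('D_b f) u - 'D_a ('D_b f) z| < e).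
    exact: continuous_near_dist c2 e0.
  by apply: filterS (filterI n1 (filterI n2 n3)) => z [? [? ?]].
have [x [y [xs ys exy]]] : exists x y, [/\ 0 <= x <= s, 0 <= y <= s &
    f (u + s *: a + s *: b) - f (u + s *: a) - (f (u + s *: b) - f u)
      = 'D_b ('D_a f) (u + x *: a + y *: b) * s * s].
  by apply: (second_difference fa fab s0) => x y xs ys; have [] := sW x y xs ys.
have [x' [y' [xs' ys' exy']]] : exists x y, [/\ 0 <= x <= s, 0 <= y <= s &
    f (u + s *: b + s *: a) - f (u + s *: b) - (f (u + s *: a) - f u)
      = 'D_a ('D_b f) (u + x *: b + y *: a) * s * s].
  by apply: (second_difference fb fba s0) => x' y' xs' ys';
    rewrite addrAC; have [] := sW y' x' ys' xs'.
have [_ l1 _] := sW _ _ xs ys; have [_ _] := sW _ _ ys' xs'.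
(* The second difference is symmetric in [a] and [b], so the two intermediate values coincide. *)
have E1 : 'D_b ('D_a f) (u + x *: a + y *: b) = 'D_a ('D_b f) (u + y' *: a + x' *: b).
  apply: (mulIf (lt0r_neq0 s0)); apply: (mulIf (lt0r_neq0 s0)).
  rewrite (addrAC u (y' *: a)); apply: etrans (esym exy) (etrans _ exy').
  rewrite (addrAC u (s *: b)); move: (f _) (f _) (f _) (f _) => p q r t; ring.
by rewrite -E1 => l2; case: (midpoint _ _ _ l1 l2).
Qed.

End LineDerivatives.

(** * Complex-valued functions of a real variable point: product rule and determinants *)

Section ComplexParts.
Variable R : realType.
Implicit Types z w : R[i].

Lemma complex_ReD z w : complex.Re (z + w) = complex.Re z + complex.Re w.
Proof. by rewrite raddfD. Qed.

Lemma complex_ImD z w : complex.Im (z + w) = complex.Im z + complex.Im w.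
Proof. by rewrite raddfD. Qed.

Lemma complex_ReM z w : complex.Re (z * w) =
  complex.Re z * complex.Re w - complex.Im z * complex.Im w.
Proof. by case: z w => [a b] [c d]. Qed.

Lemma complex_ImM z w : complex.Im (z * w) =
  complex.Re z * complex.Im w + complex.Im z * complex.Re w.
Proof. by case: z w => [a b] [c d]. Qed.

End ComplexParts.

Section ComplexDerivatives.
Variables (R : realType) (E : normedModType R) (u v : E).
Implicit Types (f g : E -> R[i]).

(** A derivative in the real direction [v], not a holomorphic one; it is therefore compatible with
    conjugation. *)
Definition is_cderive f (df : R[i]) : Prop :=
  is_derive u v (fun x => complex.Re (f x)) (complex.Re df) /\
  is_derive u v (fun x => complex.Im (f x)) (complex.Im df).

Lemma is_cderive_cst (c : R[i]) : is_cderive (fun=> c) 0.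
Proof. by split; exact: is_derive_cst. Qed.

Lemma is_cderiveD f g df dg : is_cderive f df -> is_cderive g dg ->
  is_cderive (fun x => f x + g x) (df + dg).
Proof.
move=> [f1 f2] [g1 g2]; split.
  rewrite (_ : (fun x => _) = (fun x => complex.Re (f x)) + (fun x => complex.Re (g x))).
    by rewrite raddfD; apply: is_deriveD.
  by apply/funext => x; rewrite raddfD.
rewrite (_ : (fun x => _) = (fun x => complex.Im (f x)) + (fun x => complex.Im (g x))).
  by rewrite raddfD; apply: is_deriveD.
by apply/funext => x; rewrite raddfD.
Qed.

Lemma is_cderiveM f g df dg : is_cderive f df -> is_cderive g dg ->
  is_cderive (fun x => f x * g x) (df * g u + f u * dg).
Proof.
move=> [f1 f2] [g1 g2]; split.
  rewrite (_ : (fun x => _) = (fun x => complex.Re (f x)) * (fun x => complex.Re (g x))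
      - (fun x => complex.Im (f x)) * (fun x => complex.Im (g x))).
    apply: is_derive_eq (is_deriveB (is_deriveM f1 g1) (is_deriveM f2 g2)) _.
    rewrite complex_ReD !complex_ReM /GRing.scale /=; ring.
  by apply/funext => x; rewrite complex_ReM.
rewrite (_ : (fun x => _) = (fun x => complex.Re (f x)) * (fun x => complex.Im (g x))
      + (fun x => complex.Im (f x)) * (fun x => complex.Re (g x))).
  apply: is_derive_eq (is_deriveD (is_deriveM f1 g2) (is_deriveM f2 g1)) _.
  rewrite complex_ImD !complex_ImM /GRing.scale /=; ring.
by apply/funext => x; rewrite complex_ImM.
Qed.

Lemma is_cderiveZ f (c : R[i]) df : is_cderive f df ->
  is_cderive (fun x => c * f x) (c * df).
Proof.
by move=> /(is_cderiveM (is_cderive_cst c)); rewrite mul0r add0r.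
Qed.

Lemma is_cderive_conj f df : is_cderive f df ->
  is_cderive (fun x => (f x)^*) (df^*).
Proof.
move=> [f1 f2]; split.
  rewrite (_ : (fun x => _) = (fun x => complex.Re (f x))).
    by case: df f1 {f2} => a b.
  by apply/funext => x; case: (f x).
rewrite (_ : (fun x => _) = - (fun x => complex.Im (f x))).
  by apply: is_derive_eq (is_deriveN f2) _; case: df {f1 f2}.
by apply/funext => x /=; rewrite fctE; case: (f x).
Qed.

Lemma is_cderive_sum (I : Type) (r : seq I) (F : I -> E -> R[i]) (dF : I -> R[i]) :
  (forall i, is_cderive (F i) (dF i)) ->
  is_cderive (fun x => \sum_(i <- r) F i x) (\sum_(i <- r) dF i).
Proof.
move=> H; elim: r => [|i r IH].
  rewrite big_nil (_ : (fun x => _) = fun=> 0); first exact: is_cderive_cst.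
  by apply/funext => x; rewrite big_nil.
rewrite big_cons (_ : (fun x => _) = fun x => F i x + \sum_(j <- r) F j x).
  exact: is_cderiveD.
by apply/funext => x; rewrite big_cons.
Qed.

Lemma is_cderive_prod m (F : 'I_m -> E -> R[i]) (dF : 'I_m -> R[i]) :
  (forall i, is_cderive (F i) (dF i)) ->
  is_cderive (fun x => \prod_(i < m) F i x)
    (\sum_(i < m) \prod_(j < m) if j == i then dF j else F j u).
Proof.
elim: m F dF => [|m IH] F dF H.
  rewrite big_ord0 (_ : (fun x => _) = fun=> 1); first exact: is_cderive_cst.
  by apply/funext => x; rewrite big_ord0.
rewrite (_ : (fun x => _) = fun x => F ord0 x * \prod_(i < m) F (lift ord0 i) x).
  move: (is_cderiveM (H ord0) (IH _ _ (fun i => H (lift ord0 i)))).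
  rewrite big_ord_recl big_ord_recl eqxx; congr (is_cderive _ (_ * _ + _)).
  rewrite big_distrr /=; apply: eq_bigr => i _; rewrite big_ord_recl.
  rewrite (negbTE (neq_lift _ _)); congr (_ * _).
by apply/funext => x; rewrite big_ord_recl.
Qed.

(** Jacobi's formula. Differentiating the permutation expansion replaces one row at a time by its
    derivative, and expanding along that row produces the cofactors in the adjugate. *)
Lemma is_cderive_det m (M : E -> 'M[R[i]]_m) (dM : 'M[R[i]]_m) :
  (forall i j, is_cderive (fun x => M x i j) (dM i j)) ->
  is_cderive (fun x => \det (M x)) (\tr (dM *m \adj (M u))).
Proof.
move=> H.
(* [N k] is [M u] with row [k] differentiated; its cofactors along that row are those of [M u]. *)
pose N k := \matrix_(i < m, j < m) (if i == k then dM i j else M u i j).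
have -> : \tr (dM *m \adj (M u)) = \sum_k \det (N k).
  rewrite /mxtrace; apply: eq_bigr => k _.
  rewrite (expand_det_row _ k) !mxE; apply: eq_bigr => j _.
  rewrite !mxE eqxx; congr (_ * _); rewrite /cofactor; congr (_ * \det _).
  by apply/matrixP => i l; rewrite !mxE eq_sym (negbTE (neq_lift _ _)).
rewrite /determinant exchange_big /=; apply: is_cderive_sum => s.
rewrite -big_distrr /=; apply: is_cderiveZ.
have := is_cderive_prod (fun i => H i (s i)).
congr is_cderive; apply: eq_bigr => k _; apply: eq_bigr => j _.
by rewrite !mxE.
Qed.

End ComplexDerivatives.

(** * Iterated directional derivatives of smooth maps *)

Section SmoothMaps.
Variables (R : realType) (k m : nat) (V : set 'rV[R]_k).
Implicit Types (f g : 'rV[R]_k -> 'cV[R[i]]_m) (u v : 'rV[R]_k).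

Lemma Re_dir_deriv f v (i : 'I_m) :
  (fun x => complex.Re (dir_deriv v f x i 0)) = 'D_v (fun x => complex.Re (f x i 0) : R).
Proof. by apply/funext => x; rewrite mxE. Qed.

Lemma Im_dir_deriv f v (i : 'I_m) :
  (fun x => complex.Im (dir_deriv v f x i 0)) = 'D_v (fun x => complex.Im (f x i 0) : R).
Proof. by apply/funext => x; rewrite mxE. Qed.

Lemma smooth_on_dir_deriv f v : smooth_on V f -> smooth_on V (dir_deriv v f).
Proof. by move=> fV vs i u Vu; have := fV (rcons vs v) i u Vu; rewrite foldr_rcons. Qed.

Lemma smooth_on_is_cderive f u v (i : 'I_m) : smooth_on V f -> V u ->
  is_cderive u v (fun x => f x i 0) (dir_deriv v f u i 0).
Proof.
move=> fV Vu; have [fr fi] := fV [::] i u Vu; rewrite mxE.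
by split; apply: derivableP; apply: diff_derivable.
Qed.

(** Schwarz's theorem for real and imaginary parts; continuity of the mixed derivatives comes from
    smoothness applied to lists of two directions. *)
Lemma dir_deriv_comm f u v w : open V -> smooth_on V f -> V u ->
  dir_deriv v (dir_deriv w f) u = dir_deriv w (dir_deriv v f) u.
Proof.
move=> oV fV Vu; apply/matrixP => i j; rewrite [LHS]mxE [RHS]mxE.
apply: (f_equal2 (@Complex R)).
  rewrite (Re_dir_deriv f w i) (Re_dir_deriv f v i).
  apply: (@derive_comm R _ _ V v w u oV Vu) => [x Vx|x Vx|x Vx|x Vx||].
  - by have [/diff_derivable] := fV [::] i x Vx.
  - by have [/diff_derivable] := fV [::] i x Vx.
  - by rewrite -(Re_dir_deriv f v i); have [/diff_derivable] := fV [:: v] i x Vx.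
  - by rewrite -(Re_dir_deriv f w i); have [/diff_derivable] := fV [:: w] i x Vx.
  - by rewrite -(Re_dir_deriv f v i) -(Re_dir_deriv (dir_deriv v f) w i);
      have [/differentiable_continuous] := fV [:: w; v] i u Vu.
  - by rewrite -(Re_dir_deriv f w i) -(Re_dir_deriv (dir_deriv w f) v i);
      have [/differentiable_continuous] := fV [:: v; w] i u Vu.
rewrite (Im_dir_deriv f w i) (Im_dir_deriv f v i).
apply: (@derive_comm R _ _ V v w u oV Vu) => [x Vx|x Vx|x Vx|x Vx||].
- by have [_ /diff_derivable] := fV [::] i x Vx.
- by have [_ /diff_derivable] := fV [::] i x Vx.
- by rewrite -(Im_dir_deriv f v i); have [_ /diff_derivable] := fV [:: v] i x Vx.
- by rewrite -(Im_dir_deriv f w i); have [_ /diff_derivable] := fV [:: w] i x Vx.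
- by rewrite -(Im_dir_deriv f v i) -(Im_dir_deriv (dir_deriv v f) w i);
    have [_ /differentiable_continuous] := fV [:: w; v] i u Vu.
- by rewrite -(Im_dir_deriv f w i) -(Im_dir_deriv (dir_deriv w f) v i);
    have [_ /differentiable_continuous] := fV [:: v; w] i u Vu.
Qed.

Lemma derive_partial (h : 'rV[R]_k -> R) u v : differentiable h u ->
  'D_v h u = \sum_(j < k) v 0 j * 'D_(delta_mx 0 j) h u.
Proof.
move=> dh; rewrite deriveE // [in LHS](row_sum_delta v) linear_sum.
by apply: eq_bigr => j _; rewrite linearZ deriveE.
Qed.

Lemma dir_deriv_partial f u v : smooth_on V f -> V u ->
  dir_deriv v f u = \sum_(j < k) (v 0 j)%:C *: partial j f u.
Proof.
move=> fV Vu; apply/matrixP => i z; rewrite (ord1 z) summxE mxE.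
have [fr fi] := fV [::] i u Vu.
rewrite (derive_partial _ fr) (derive_partial _ fi).
transitivity (\sum_(j < k) ((v 0 j * 'D_(delta_mx 0 j) (fun x => complex.Re (f x i 0) : R) u)
   +i* (v 0 j * 'D_(delta_mx 0 j) (fun x => complex.Im (f x i 0) : R) u))).
  by apply/eqP; rewrite eq_complex /= !raddf_sum /= !eqxx.
apply: eq_bigr => j _; rewrite /partial [RHS]mxE [X in _ = _ * X]mxE.
by apply/eqP; rewrite eq_complex /= !mul0r subr0 addr0 !eqxx.
Qed.

End SmoothMaps.

(** * The Hermitian product and the symplectic form *)

Section HermitianProduct.
Variables (R : realType) (m : nat).
Implicit Types (z w : 'cV[R[i]]_m).

(** Conjugate-linear in the first argument, so that the imaginary part is [omega] rather than its
    opposite. *)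
Definition herm z w : R[i] := \sum_(j < m) (z j 0)^* * w j 0.

Lemma Re_herm z w : complex.Re (herm z w) = inner z w.
Proof.
rewrite /herm /inner raddf_sum /=; apply: eq_bigr => j _.
by case: (z j 0) (w j 0) => [a b] [c d] /=; ring.
Qed.

Lemma Im_herm z w : complex.Im (herm z w) = omega z w.
Proof.
rewrite /herm /omega raddf_sum /=; apply: eq_bigr => j _.
by case: (z j 0) (w j 0) => [a b] [c d] /=; ring.
Qed.

Lemma hermE z w : herm z w = inner z w +i* omega z w.
Proof. by rewrite -Re_herm -Im_herm; case: herm. Qed.

Lemma omegaC z w : omega w z = - omega z w.
Proof. by rewrite /omega -sumrN; apply: eq_bigr => j _; ring. Qed.

Lemma innerC z w : inner w z = inner z w.
Proof. by rewrite /inner; apply: eq_bigr => j _; ring. Qed.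

Lemma omegaD z w1 w2 : omega z (w1 + w2) = omega z w1 + omega z w2.
Proof.
by rewrite /omega -big_split; apply: eq_bigr => j _; rewrite mxE complex_ReD complex_ImD /=;
  ring.
Qed.

Lemma omegaZ z w (a : R) : omega z (a%:C *: w) = a * omega z w.
Proof.
by rewrite /omega big_distrr; apply: eq_bigr => j _; rewrite mxE complex_ReM complex_ImM /=;
  ring.
Qed.

Lemma omega0 z : omega z 0 = 0.
Proof. by rewrite /omega big1 // => j _; rewrite mxE /= !mulr0 subr0. Qed.

Lemma omegaN z w : omega z (- w) = - omega z w.
Proof. by rewrite -[- w]scaleN1r -[(-1 : R[i])](rmorphN1 (real_complex R)) omegaZ mulN1r. Qed.

Lemma omega_sum (I : Type) (r : seq I) (P : pred I) (F : I -> 'cV[R[i]]_m) z :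
  omega z (\sum_(j <- r | P j) F j) = \sum_(j <- r | P j) omega z (F j).
Proof. exact: (big_morph (omega z) (omegaD z) (omega0 z)). Qed.

Lemma inner_eq0 z : inner z z = 0 -> z = 0.
Proof.
move=> /eqP; rewrite psumr_eq0 => [/allP H|j _]; last by rewrite -!expr2 addr_ge0 ?sqr_ge0.
apply/matrixP => i j; rewrite (ord1 j) mxE.
have /implyP/(_ isT) := H i (mem_index_enum _).
rewrite -!expr2 paddr_eq0 ?sqr_ge0 // !sqrf_eq0 => /andP[/eqP a /eqP b].
by apply/eqP; rewrite eq_complex a b /= eqxx.
Qed.

End HermitianProduct.

Lemma is_cderive_herm (R : realType) (k m : nat) (V : set 'rV[R]_k)
    (f g : 'rV[R]_k -> 'cV[R[i]]_m) u v :
  smooth_on V f -> smooth_on V g -> V u ->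
  is_cderive u v (fun x => herm (f x) (g x))
    (herm (dir_deriv v f u) (g u) + herm (f u) (dir_deriv v g u)).
Proof.
move=> fV gV Vu; rewrite /herm -big_split /=; apply: is_cderive_sum => j.
apply: is_cderiveM; last exact: smooth_on_is_cderive Vu.
by apply: is_cderive_conj; exact: smooth_on_is_cderive Vu.
Qed.

(** * Phases of complex functions along a line *)

Section PhaseOnALine.
Variable R : realType.

Lemma is_cderive_line (E : normedModType R) (f : E -> R[i]) (u v : E) (s : R) df :
  is_cderive (u + s *: v) v f df ->
  is_cderive s 1 (fun x : R => f (u + x *: v)) df.
Proof. by move=> [/is_derive_line ? /is_derive_line ?]; split. Qed.

Lemma is_cderive_expi (y : R -> R) (s dy : R) : is_derive s 1 y dy ->
  is_cderive s 1 (fun x => expi (y x)) ((0 +i* dy) * expi (y s)).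
Proof.
move=> dY; split=> /=.
  by apply: is_derive_eq (is_derive1_comp (is_derive_cos (y s)) dY) _; ring.
by apply: is_derive_eq (is_derive1_comp (is_derive_sin (y s)) dY) _; ring.
Qed.

(* [k' / k] real makes [Im k / Re k] constant. *)
Lemma real_logderive_phase (k : R -> R[i]) (r : R -> R) :
  (forall s : R, 0 <= s <= 1 -> is_cderive s 1 k (k s * (r s)%:C)) ->
  (forall s : R, 0 <= s <= 1 -> 0 < complex.Re (k s)) ->
  complex.Im (k 0) = 0 -> complex.Im (k 1) = 0.
Proof.
move=> dk kgt0 k0.
pose q s := complex.Im (k s) * (complex.Re (k s))^-1.
have dq (s : R) : 0 <= s <= 1 -> is_derive s 1 q 0.
  move=> s01; have [d1 d2] := dk s s01; have Rk := lt0r_neq0 (kgt0 s s01).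
  apply: is_derive_eq (is_deriveM d2 (is_deriveV Rk d1)) _.
  rewrite /GRing.scale /= complex_ReM complex_ImM /=; field; exact: Rk.
have D (x : R) : x \in `]0, 1[ -> is_derive x 1 q ((fun=> 0) x).
  by rewrite in_itv /= => /andP[a b]; apply: dq; rewrite !ltW.
have C : {within `[0, 1], continuous q}.
  by apply: derivable_within_continuous => x; rewrite in_itv /= => /dq [].
have [x _] := MVT ltr01 D C.
rewrite mul0r {2}/q k0 mul0r subr0 => /eqP.
have k1 : 0 < complex.Re (k 1) by apply: kgt0; rewrite ler01 lexx.
by rewrite mulf_eq0 invr_eq0 (gt_eqF k1) orbF => /eqP.
Qed.

End PhaseOnALine.

(** * Real linearity of the inner product *)

Section InnerBilinear.
Variables (R : realType) (m : nat).
Implicit Types (z w : 'cV[R[i]]_m).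

Lemma innerD z w1 w2 : inner z (w1 + w2) = inner z w1 + inner z w2.
Proof.
by rewrite /inner -big_split; apply: eq_bigr => j _; rewrite mxE complex_ReD complex_ImD /=; ring.
Qed.

Lemma innerZ z w (a : R) : inner z (a%:C *: w) = a * inner z w.
Proof.
by rewrite /inner big_distrr; apply: eq_bigr => j _; rewrite mxE complex_ReM complex_ImM /=; ring.
Qed.

Lemma inner0 z : inner z 0 = 0.
Proof. by rewrite /inner big1 // => j _; rewrite mxE /= !mulr0 addr0. Qed.

Lemma inner_sum (I : Type) (r : seq I) (P : pred I) (F : I -> 'cV[R[i]]_m) z :
  inner z (\sum_(j <- r | P j) F j) = \sum_(j <- r | P j) inner z (F j).
Proof. exact: (big_morph (inner z) (innerD z) (inner0 z)). Qed.

End InnerBilinear.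

(** * Tangent vectors, Gram matrix and second derivatives of a Lagrangian parametrization *)

Section LagrangianParametrization.
Variables (R : realType) (m : nat) (V : set 'rV[R]_m).
Variable F : 'rV[R]_m -> 'cV[R[i]]_m.
Hypotheses (openV : open V) (smoothF : smooth_on V F).
Hypothesis immF : immersion_on V F.
Hypothesis lagF : forall u, V u -> forall i j, omega (partial i F u) (partial j F u) = 0.

Lemma omega_tangent u v w : V u -> omega (dir_deriv v F u) (dir_deriv w F u) = 0.
Proof.
move=> Vu; rewrite !(dir_deriv_partial _ smoothF Vu) omega_sum big1 // => j _.
rewrite omegaZ omegaC omega_sum big1 ?oppr0 ?mulr0 // => i _.
by rewrite omegaZ lagF // mulr0.
Qed.

(** The entries are Hermitian products of coordinate vectors, whose imaginary parts vanish by the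
    Lagrangian condition. *)
Lemma jac_gram u : V u ->
  (map_mx conjc (jac F u))^T *m jac F u = map_mx (real_complex R) (first_form F u).
Proof.
move=> Vu; apply/matrixP => i j; rewrite [RHS]mxE [X in _ = X%:C]mxE [LHS]mxE.
transitivity (herm (partial i F u) (partial j F u)).
  by apply: eq_bigr => a _; rewrite !(mxE, mxE _ _ a).
by rewrite hermE lagF.
Qed.

(** A kernel vector of the Gram matrix gives a tangent vector of zero length, which the immersion
    property excludes unless the vector is zero. *)
Lemma first_form_unit u : V u -> first_form F u \in unitmx.
Proof.
move=> Vu; rewrite unitmxE unitfE; apply/negP => /det0P [v v0 vg].
suff : v = 0 by move/eqP; rewrite (negbTE v0).
apply: (immF Vu); apply: inner_eq0.
rewrite [X in inner _ X](dir_deriv_partial _ smoothF Vu) inner_sum big1 // => i _.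
rewrite innerZ innerC (dir_deriv_partial _ smoothF Vu) inner_sum.
have := congr1 (fun A : 'rV[R]_m => A 0 i) vg; rewrite mxE [RHS]mxE => vgi.
rewrite (eq_bigr (fun j => v 0 j * first_form F u j i)) ?vgi ?mulr0 // => j _.
by rewrite innerZ [first_form _ _ _ _]mxE innerC.
Qed.

(** The normal part differs from [w] by a tangent vector, on which [omega] vanishes against tangent
    vectors. This lets normal projections be dropped on both sides of the soliton equation. *)
Lemma omega_normal_part u v w : V u ->
  omega (dir_deriv v F u) (normal_part F u w) = omega (dir_deriv v F u) w.
Proof.
move=> Vu; rewrite omegaD omegaN omega_sum big1 ?subr0 // => i _.
rewrite omega_sum big1 // => j _.
by rewrite omegaZ omega_tangent // mulr0.
Qed.

(** Differentiating [omega (partial j F) (dir_deriv v F) = 0] in the direction [i] gives two terms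
    with sum zero; commuting derivatives and antisymmetry of [omega] do the rest. *)
Lemma second_deriv_sym u v (i j : 'I_m) : V u ->
  omega (partial j F u) (dir_deriv v (partial i F) u)
    = omega (dir_deriv v F u) (partial i (partial j F) u).
Proof.
move=> Vu.
have sF w := smooth_on_dir_deriv w smoothF.
have [_ d] := is_cderive_herm (delta_mx 0 i) (sF (delta_mx 0 j)) (sF v) Vu.
(* The differentiated identity holds only on [V], which suffices because derivatives are local and
   [V] is open. *)
have nV : nbhs u V by exact: open_nbhs_nbhs.
have d0 : is_derive u (delta_mx 0 i : 'rV[R]_m)
  (fun x => complex.Im (herm (partial j F x) (dir_deriv v F x))) 0.
  apply: near_eq_is_derive (is_derive_cst (0 : R) u (delta_mx 0 i)).
  by apply: filterS nV => x Vx; rewrite Im_herm omega_tangent.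
have := derive_val (is_derive := d); rewrite (derive_val (is_derive := d0)).
rewrite complex_ImD !Im_herm /partial => e.
rewrite (dir_deriv_comm v (delta_mx 0 i) openV smoothF Vu) [RHS]omegaC.
by apply/eqP; rewrite -addr_eq0 addrC -e.
Qed.

End LagrangianParametrization.

(** * The logarithmic derivative of the Jacobian determinant and the mean curvature *)

Section LagrangianAngle.
Variables (R : realType) (m : nat) (V : set 'rV[R]_m).
Variable F : 'rV[R]_m -> 'cV[R[i]]_m.
Hypotheses (openV : open V) (smoothF : smooth_on V F).
Hypothesis immF : immersion_on V F.
Hypothesis lagF : forall u, V u -> forall i j, omega (partial i F u) (partial j F u) = 0.

(** The Gram identity exhibits a left inverse of the Jacobian; for a square matrix it is also a
    right inverse. *)
Lemma jac_inverse u : V u ->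
  jac F u *m (map_mx (real_complex R) (invmx (first_form F u))
    *m (map_mx conjc (jac F u))^T) = 1%:M.
Proof.
move=> Vu; apply: mulmx1C; rewrite -mulmxA (jac_gram lagF Vu) -map_mxM.
by rewrite mulVmx ?map_mx1 // (first_form_unit smoothF immF Vu).
Qed.

Lemma det_jac_neq0 u : V u -> \det (jac F u) != 0.
Proof.
move=> /jac_inverse /(congr1 determinant); rewrite det_mulmx det1 => e.
by apply/eqP => d0; move/eqP: e; rewrite d0 mul0r eq_sym oner_eq0.
Qed.

Lemma adj_jac u : V u -> \adj (jac F u) = \det (jac F u) *:
  (map_mx (real_complex R) (invmx (first_form F u)) *m (map_mx conjc (jac F u))^T).
Proof.
move=> Vu; rewrite -[LHS]mulmx1 -(jac_inverse Vu) (mulmxA (\adj _)) mul_adj_mx.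
by rewrite mul_scalar_mx.
Qed.

Definition jac_deriv v u : 'M[R[i]]_m :=
  \matrix_(i, j) dir_deriv v (partial j F) u i 0.

(** This is [tr (J^-1 J')], the logarithmic derivative of the Jacobian determinant, with the inverse
    written through the Gram matrix; no branch of the logarithm is chosen. *)
Definition log_det_deriv v u : R[i] :=
  \tr (map_mx (real_complex R) (invmx (first_form F u))
    *m ((map_mx conjc (jac F u))^T *m jac_deriv v u)).

Lemma is_cderive_det_jac u v : V u ->
  is_cderive u v (fun x => \det (jac F x)) (\det (jac F u) * log_det_deriv v u).
Proof.
move=> Vu; rewrite /log_det_deriv mulmxA mxtrace_mulC -mxtraceZ scalemxAr -adj_jac //.
apply: is_cderive_det => i j.
rewrite (_ : (fun x => _) = fun x => partial j F x i 0); last first.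
  by apply/funext => x; rewrite mxE.
rewrite [jac_deriv _ _ _ _]mxE; apply: smooth_on_is_cderive Vu.
exact: smooth_on_dir_deriv.
Qed.

(** Both sides are sums over [i] and [j] with the same inverse Gram coefficients. They agree term by
    term, by [second_deriv_sym] and the removal of normal projections. *)
Lemma Im_log_det_deriv u v : V u ->
  complex.Im (log_det_deriv v u) = omega (dir_deriv v F u) (mean_curvature F u).
Proof.
move=> Vu; rewrite /mean_curvature omega_sum /log_det_deriv /mxtrace raddf_sum.
apply: eq_bigr => i _; rewrite mxE raddf_sum omega_sum; apply: eq_bigr => j _.
rewrite omegaZ (omega_normal_part smoothF lagF) // -(second_deriv_sym openV smoothF lagF) //.
rewrite [X in X * _]mxE [X in _ * X]mxE.
rewrite (eq_bigr (fun a => (partial j F u a 0)^* * (dir_deriv v (partial i F) u a 0))).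
  by rewrite /= complex_ImM /= mul0r addr0 -[\sum_(_ < _) _]/(herm _ _) Im_herm.
by move=> a _; rewrite !mxE.
Qed.

End LagrangianAngle.

Lemma omega_e_last (R : realType) n (z : 'cV[R[i]]_(n + 1)) :
  omega z (e_last R n) = - complex.Im (z (last_ord n) 0).
Proof.
rewrite /omega (bigD1 (last_ord n)) //= big1 => [|j /negbTE jl].
  by rewrite mxE !eqxx /= mulr0 mulr1 sub0r addr0.
by rewrite mxE jl /= !mulr0 subr0.
Qed.

(** The threshold 1, here and for the cosine below, is small enough because [pi] is at least 2. *)
Lemma sin_eq0_small (R : realType) (t : R) : `|t| < 1 -> sin t = 0 -> t = 0.
Proof.
wlog t0 : t / 0 <= t.
  move=> W; have [|/ltW t0] := leP 0 t; first exact: W.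
  by rewrite -normrN => /W + s0; rewrite sinN s0 oppr0 oppr_ge0 => /(_ t0 erefl) /eqP;
    rewrite oppr_eq0 => /eqP.
rewrite ger0_norm // => t1 st; apply/eqP; rewrite eq_le t0 andbT leNgt.
apply/negP => tp; have tpi : t < pi by have := pi_ge2 R; lra.
by have := @sin_gt0_pi R t; rewrite st ltxx tp tpi => /(_ isT).
Qed.

Lemma cos_gt0_small (R : realType) (t : R) : `|t| < 1 -> 0 < cos t.
Proof.
rewrite ltr_norml => /andP[a b]; have := pi_ge2 R => p.
by apply: cos_gt0_pihalf; apply/andP; split; lra.
Qed.

(** Used to compare [\det J * expi y] at two points: the moduli multiply and the phases subtract. *)
Lemma conj_expi_mul (R : realType) (a b c d p q : R) :
  (expi a * p%:C * expi b)^* * (expi c * q%:C * expi d)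
    = (p * q)%:C * expi (c + d - (a + b)).
Proof.
rewrite /expi sinB cosB !sinD !cosD.
by apply/eqP; rewrite eq_complex /=; apply/andP; split; apply/eqP; ring.
Qed.

(** * Local constancy of angle plus height in one parametrization *)

Section SolitonParametrization.
Variables (R : realType) (n : nat) (V : set 'rV[R]_(n + 1)).
Variable F : 'rV[R]_(n + 1) -> 'cV[R[i]]_(n + 1).
Hypotheses (openV : open V) (smoothF : smooth_on V F).
Hypothesis immF : immersion_on V F.
Hypothesis lagF : forall u, V u -> forall i j, omega (partial i F u) (partial j F u) = 0.
Hypothesis solF : forall u, V u -> mean_curvature F u = normal_part F u (e_last R n).

Let y u : R := complex.Im (F u (last_ord n) 0).

Lemma Im_log_det_soliton u v : V u ->
  complex.Im (log_det_deriv F v u) = - complex.Im (dir_deriv v F u (last_ord n) 0).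
Proof.
move=> Vu; rewrite (Im_log_det_deriv openV smoothF lagF) // solF //.
by rewrite (omega_normal_part smoothF lagF) // omega_e_last.
Qed.

(** The factor [expi y] adds [i dy] to the logarithmic derivative of the determinant, which cancels
    its imaginary part on a soliton. *)
Lemma det_jac_phase_deriv u v (s : R) : V (u + s *: v) ->
  let h x := \det (jac F (u + x *: v)) * expi (y (u + x *: v)) in
  is_cderive s 1 h (h s * (complex.Re (log_det_deriv F v (u + s *: v)))%:C).
Proof.
move=> Vs h.
have d1 := is_cderive_line (is_cderive_det_jac smoothF immF lagF v Vs).
have [_ /is_derive_line /is_cderive_expi d2] := smooth_on_is_cderive v (last_ord n) smoothF Vs.
have := is_cderiveM d1 d2; congr is_cderive.
have := Im_log_det_soliton v Vs; rewrite /h /y.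
case: (log_det_deriv _ _ _) => a b /= ->.
move: (dir_deriv _ _ _ _ _) => [p q] /=.
rewrite -[LHS]/(_ * _ * _ + _ * (_ * _)).
rewrite -[X in _ = X]mulrAC.
move: (\det _) (expi _) => [? ?] [? ?].
by apply/eqP; rewrite eq_complex /=; apply/andP; split; apply/eqP; ring.
Qed.

(** The phase of [\det J * expi y] is [th + y], and a real logarithmic derivative fixes the phase
    along segments. As [th] is only known to be continuous, this argument differentiates the
    determinant and not [th]. *)
Lemma angle_locally_constant (th : 'rV[R]_(n + 1) -> R) u :
  (forall x, V x -> \det (jac F x) = expi (th x) * (vol_density F x)%:C) ->
  {for u, continuous th} -> V u ->
  \forall x \near u, th x + y x = th u + y u.
Proof.
move=> angle cth Vu.
have volgt0 x : V x -> 0 < vol_density F x.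
  move=> Vx; rewrite lt0r sqrtr_ge0 andbT; apply/eqP => v0.
  by have := det_jac_neq0 smoothF immF lagF Vx; rewrite angle // v0 mulr0 eqxx.
have cy : {for u, continuous y}.
  by apply: differentiable_continuous; have [] := smoothF [::] (last_ord n) Vu.
have n1 : nbhs u V by exact: open_nbhs_nbhs.
(* A variation below 1 keeps the cosine of the phase difference positive and rules out jumps by
   multiples of [pi]. *)
have n2 : nbhs u (fun x => `|(th u + y u) - (th x + y x)| < 1).
  exact: (continuous_near_dist (f := th + y) (continuousD cth cy) ltr01).
have n12 : nbhs u (V `&` (fun x => `|(th u + y u) - (th x + y x)| < 1)).
  exact: filterI.
move: n12 => /nbhs_ballP [r /= r0 rW].
apply/nbhs_ballP; exists r => // x xr; pose v := x - u.
have W s : 0 <= s <= 1 -> V (u + s *: v) /\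
    `|(th u + y u) - (th (u + s *: v) + y (u + s *: v))| < 1.
  move=> /andP[s0 s1]; apply: rW; move: xr.
  rewrite -ball_normE /ball_ /= opprD addNKr normrN normrZ ger0_norm // distrC.
  by apply: le_lt_trans; rewrite ler_piMl.
pose h s := \det (jac F (u + s *: v)) * expi (y (u + s *: v)).
(* Multiplying by the conjugate of the initial value makes the curve start on the positive real
   axis. *)
pose k s := (h 0)^* * h s.
pose d s := (th (u + s *: v) + y (u + s *: v)) - (th u + y u).
have kE s : 0 <= s <= 1 -> k s =
    (vol_density F u * vol_density F (u + s *: v))%:C * expi (d s).
  move=> s01; have [Vs _] := W s s01; rewrite /k /h /d scale0r addr0 !angle //.
  exact: conj_expi_mul.
have d1 s : 0 <= s <= 1 -> `|d s| < 1 by rewrite distrC; case/W.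
have kp s : 0 <= s <= 1 -> 0 < vol_density F u * vol_density F (u + s *: v).
  by move=> /W [Vs _]; rewrite mulr_gt0 ?volgt0.
have : complex.Im (k 1) = 0.
  apply: (@real_logderive_phase R k (fun s => complex.Re (log_det_deriv F v (u + s *: v)))).
  - move=> s s01; have [Vs _] := W s s01.
    by have := is_cderiveZ (h 0)^* (det_jac_phase_deriv Vs); rewrite mulrA.
  - move=> s s01; rewrite kE // complex_ReM /= mul0r subr0 mulr_gt0 ?kp //.
    by apply: cos_gt0_small; exact: d1.
  - by rewrite kE ?lexx ?ler01 // complex_ImM /= mul0r addr0 /d scale0r addr0 subrr sin0 mulr0.
have I1 : 0 <= (1 : R) <= 1 by rewrite ler01 lexx.
rewrite kE // complex_ImM /= mul0r addr0 => /eqP.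
rewrite mulf_eq0 gt_eqF ?kp //= => /eqP /(sin_eq0_small (d1 _ I1)) /eqP.
by rewrite subr_eq0 scale1r /v subrKC => /eqP.
Qed.

End SolitonParametrization.

(** * Passage from parametrizations to the whole of [L] *)

Section AnglePlusHeight.
Variables (R : realType) (n : nat) (L : submanifold R (n + 1) (n + 1)).
Variable theta : L -> R.
Hypotheses (solL : lagrangian_translating_soliton L).
Hypotheses (ctheta : continuous theta) (angle : lagrangian_angle theta).

Let height (p : L) : R := complex.Im (imm L p (last_ord n) 0).

(** The local result holds on an open set of parameters, which [phi] maps to an open set of [L]. *)
Lemma nbhs_angle_level (p : L) :
  nbhs p [set q | theta q + height q = theta p + height p].
Proof.
case: solL => _ lagL sol.
have [[V phi] cL [u /= Vu <-]] := atlas_cover p.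
have [oV cphi _ ophi [sm im]] := atlas_param cL.
have cth : {for u, continuous (theta \o phi)}.
  by apply: continuous_comp; [apply: cphi; rewrite inE|exact: ctheta].
have lagV x (Vx : V x) := lagL _ x cL Vx.
have solV x (Vx : V x) := sol _ x cL Vx.
have angleV x (Vx : V x) : \det (jac (imm L \o phi) x) =
    expi ((theta \o phi) x) * (vol_density (imm L \o phi) x)%:C.
  exact: angle cL Vx.
pose S x := theta (phi x) + height (phi x) = theta (phi u) + height (phi u).
have nS : nbhs u S := angle_locally_constant oV sm im lagV solV angleV cth Vu.
have nVS : nbhs u (V `&` S) by apply: filterI => //; exact: open_nbhs_nbhs.
have oW : open (phi @` (V `&` S)^°).
  by apply: ophi; [exact: open_interior|move=> x /interior_subset []].
apply: (filterS _ (open_nbhs_nbhs (conj oW _))).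
  by move=> _ [x /interior_subset [_ Sx] <-].
by exists u => //; exact: nbhs_interior.
Qed.

(** Every level set is open, and so is its complement as a union of other level sets; a nonempty one
    is everything by connectedness. *)
Lemma angle_plus_height_constant (p q : L) : connected [set: L] ->
  theta p + height p = theta q + height q.
Proof.
move=> cL; pose B := [set x : L | theta x + height x = theta q + height q].
suff -> : B p by [].
suff -> : B = setT by [].
apply: cL; first by exists q.
  exists B; last by rewrite setTI.
  by rewrite openE => x /= Bx; move: (nbhs_angle_level x); rewrite Bx.
exists B; last by rewrite setTI.
rewrite -[B]setCK closedC openE => x /= Bx; apply: filterS (nbhs_angle_level x).
by move=> y /= e By; apply: Bx; rewrite /B /= -e.
Qed.

End AnglePlusHeight.

(** * The form of the elements of [Gf] *)

Section GroupGf.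
Variable R : realType.
Implicit Types z w : R[i].

Lemma cexp_norm z : cexp z * (cexp z)^* = (expR (complex.Re z) ^+ 2)%:C.
Proof.
have := cos2Dsin2 (complex.Im z).
case: z => x y /=; rewrite /cexp /expi /= => e.
apply/eqP; rewrite eq_complex /= -[X in _ == X]mulr1 -e.
by apply/andP; split; apply/eqP; ring.
Qed.

Lemma det_unitary_norm m (A : 'M[R[i]]_m) : A \is unitarymx ->
  \det A * (\det A)^* = 1.
Proof.
move=> /unitarymxP /(congr1 determinant); rewrite det_mulmx det1 => <-.
by rewrite det_map_mx det_tr.
Qed.

(** Squared moduli eliminate [d] and depend only on the real parts, through the injective [expR]. *)
Lemma cexp_unit_mul_Re z w (d : R[i]) : d * d^* = 1 -> cexp z * d = cexp w ->
  complex.Re z = complex.Re w.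
Proof.
move=> dd e; have := cexp_norm w; rewrite -e rmorphM mulrACA dd mulr1 cexp_norm.
move=> /(congr1 (@complex.Re R)) /= /eqP.
by rewrite eqrXn2 ?expR_ge0 // => /eqP /expR_inj.
Qed.

Variable n : nat.
Implicit Types g : affine R (n + 1).

Lemma Gf_Re_last g (z : 'cV[R[i]]_(n + 1)) : Gf g ->
  complex.Re (act g z (last_ord n) 0) = complex.Re (z (last_ord n) 0).
Proof.
move=> [/= gU gO]; apply: (cexp_unit_mul_Re (det_unitary_norm gU)).
by have := gO z 1%:M; rewrite /Omega_f mulmx1 det1 mulr1.
Qed.

Lemma Gf_Re_translation g : Gf g -> complex.Re (g.2 (last_ord n) 0) = 0.
Proof. by move=> /(Gf_Re_last 0); rewrite /act mulmx0 add0r => ->; rewrite mxE. Qed.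

Lemma Gf_last_row g j : Gf g -> g.1 (last_ord n) j = (j == last_ord n)%:R.
Proof.
(* Real parts alone determine the entry once they are known for the multiples by 1 and by ['i]. *)
move=> gG; have H (c : R[i]) : complex.Re (c * g.1 (last_ord n) j) =
    complex.Re (c * (j == last_ord n)%:R).
  have := Gf_Re_last (c *: delta_mx j 0) gG.
  rewrite /act mxE complex_ReD Gf_Re_translation // addr0 -scalemxAr -colE !mxE.
  by rewrite eqxx andbT eq_sym.
have := H 1; have := H 'i; rewrite !mul1r !complex_ReM /=.
case: (g.1 _ _) => a b /=; rewrite !mul0r !sub0r !mul1r => /oppr_inj bi ar.
by apply/eqP; rewrite eq_complex ar bi !eqxx.
Qed.

Lemma Gf_det g : Gf g -> cexp (g.2 (last_ord n) 0) * \det g.1 = 1.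
Proof.
move=> [_ /(_ 0 1%:M)]; rewrite /Omega_f mulmx1 det1 mulr1 /act mulmx0 add0r => ->.
by rewrite mxE /cexp /expi /= expR0 cos0 sin0 mul1r.
Qed.

Lemma Gf_act_last g (z : 'cV[R[i]]_(n + 1)) : Gf g ->
  act g z (last_ord n) 0 = z (last_ord n) 0 + g.2 (last_ord n) 0.
Proof.
move=> gG; rewrite /act mxE; congr (_ + _); rewrite mxE (bigD1 (last_ord n)) //=.
rewrite Gf_last_row // eqxx mul1r big1 ?addr0 // => j /negbTE jl.
by rewrite Gf_last_row // jl mul0r.
Qed.

(** The real part of the last translation entry already vanishes, so invariance of the form at the
    origin reduces to [\det A = 1]; unitarity turns the standard last row into the block form. *)
Lemma Gf_ASU g : Gf g -> complex.Im (g.2 (last_ord n) 0) = 0 -> ASU g.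
Proof.
case: g => A t gG /= t0.
have {}t0 : t (last_ord n) 0 = 0.
  by apply/eqP; rewrite eq_complex (Gf_Re_translation gG) t0 /= !eqxx.
have Adet : \det A = 1.
  have := Gf_det gG; rewrite /= t0 /cexp /expi /= expR0 cos0 sin0 mul1r => <-.
  by rewrite mul1r.
have Arow j : A (last_ord n) j = (j == last_ord n)%:R := Gf_last_row j gG.
have [/unitarymxP AU _] := gG; rewrite /= in AU.
have dl0 : dlsubmx A = 0.
  apply/matrixP => i j; rewrite (ord1 i) !mxE.
  by rewrite -[rshift _ _]/(last_ord n) Arow eq_lrshift.
have dr1 : drsubmx A = 1%:M.
  apply/matrixP => i j; rewrite (ord1 i) (ord1 j) !mxE.
  by rewrite -[rshift _ _]/(last_ord n) Arow !eqxx.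
(* The last row is a standard basis vector, so orthogonality of another row to it says that the last
   entry of that row is zero. *)
have ur0 : ursubmx A = 0.
  apply/matrixP => i j; rewrite (ord1 j) !mxE -[rshift _ _]/(last_ord n).
  have := congr1 (fun M : 'M[R[i]]_(n + 1) => M (lshift 1 i) (last_ord n)) AU.
  rewrite !mxE eq_lrshift (bigD1 (last_ord n)) //= big1 => [|k /negbTE kl].
    by rewrite !mxE Arow eqxx rmorph1 mulr1 addr0.
  by rewrite !mxE Arow kl rmorph0 mulr0.
have Ablock : A = block_mx (ulsubmx A) 0 0 1%:M by rewrite -{1}(submxK A) dl0 dr1 ur0.
exists (ulsubmx A), (usubmx t); split.
- apply/unitarymxP; move: AU; rewrite Ablock tr_block_mx map_block_mx mulmx_block.
  rewrite scalar_mx_block => /eq_block_mx [+ _ _ _].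
  by rewrite mul0mx addr0 block_mxKul.
- by have := Adet; rewrite Ablock det_ublock det1 mulr1 block_mxKul.
congr (_, _); first exact: Ablock.
rewrite -{1}(vsubmxK t); congr col_mx; apply/matrixP => i j.
by rewrite (ord1 i) (ord1 j) !mxE -[rshift _ _]/(last_ord n) t0.
Qed.

End GroupGf.

(** * Bounded translations and the conclusion *)

Lemma bounded_multiples_eq0 (R : realType) (t M : R) :
  (forall k : nat, `|t *+ k| <= M) -> t = 0.
Proof.
move=> H; apply/eqP; rewrite -normr_eq0; apply: contraT => t0.
have tp : 0 < `|t| by rewrite lt0r t0 normr_ge0.
(* Archimedean choice: the first integer above [M / |t|] violates the bound. *)
have := H (Num.truncn (M / `|t|)).+1; rewrite normrMn leNgt -mulr_natl -ltr_pdivrMr //.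
by rewrite truncnS_gt.
Qed.

Theorem proposition3p2 (R : realType) (n : nat) (hm : (2 <= n + 1)%N)
  (G : set (affine R (n + 1))) (hG : is_subgroup G (@Gf R n))
  (L : submanifold R (n + 1) (n + 1))
  (L_nonempty : [set: L] !=set0) (L_connected : connected [set: L])
  (L_soliton : lagrangian_translating_soliton L)
  (L_calibrated : almost_calibrated L)
  (L_no_linear_factor : ~ has_linear_factor L)
  (L_invariant : invariant_under G L) :
  is_subgroup G (@ASU R n).
Proof.
have [subG G1 GM GV] := hG; split=> // g Gg; have gGf := subG g Gg.
have [theta [ctheta angle [a [b [_ bound]]]]] := L_calibrated.
have [p0 _] := L_nonempty.
apply: (Gf_ASU gGf); set t := g.2 (last_ord n) 0.
(* Invariance concerns the image of [L], so each new point is a preimage of the translate by [g] of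
   the previous one. *)
have orbit k : exists q, imm L q (last_ord n) 0 = imm L p0 (last_ord n) 0 + t *+ k.
  elim: k => [|k [q eq]]; first by exists p0; rewrite mulr0n addr0.
  have : range (imm L) (act g (imm L q)) by rewrite -(L_invariant g Gg); exists (imm L q).
  by case=> q' _ e; exists q'; rewrite e Gf_act_last // eq mulrSr addrA.
(* Constancy of angle plus height makes the multiple of the imaginary part of [t] a difference of
   two angles, both between [a] and [b]. *)
apply: (@bounded_multiples_eq0 _ _ (b - a)) => k.
have [q eq] := orbit k.
have := angle_plus_height_constant L_soliton ctheta angle p0 q L_connected.
rewrite eq complex_ImD raddfMn; have /andP[] := bound p0; have /andP[] := bound q.
move: (_ *+ k) (theta _) (theta _) (complex.Im _) => x y z w *.
by rewrite ler_norml; apply/andP; split; lra.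
Qed.
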